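(* Let $\alpha$ be an irrational number that is not of golden type and let $\lambda\in(0,1)$. Then the nonsingular rank-one transformation $T_{\alpha,\lambda}$ described in the context is of type III$_\lambda$.
   Context: For an irrational $\alpha=[a_0;a_1,a_2,\dots]$ put $q_0=0,\ q_1=1$ and $q_k=a_{k-1}q_{k-1}+q_{k-2}$ for $k\ge 2$. $\alpha$ is of golden type if there is $n$ with $a_k=1$ for all $k\ge n$. Construction of $T_{\alpha,\lambda}$. All intervals are left-open and right-closed, and $\mu$ denotes Lebesgue measure. The column $C_1$ consists of one level, the unit interval. Suppose the column $C_k$, consisting of $q_k$ disjoint intervals (levels, not necessarily of the same length) $C_k(0),\dots,C_k(q_k-1)$, has been constructed. Cut each level $I$ of $C_k$ into $a_k$ pieces: from left to right, first $\lceil a_k/2\rceil$ pieces each of length $\frac{1}{\lceil a_k/2\rceil+\lambda\lfloor a_k/2\rfloor}\mu(I)$, then $\lfloor a_k/2\rfloor$ pieces each of length $\frac{\lambda}{\lceil a_k/2\rceil+\lambda\lfloor a_k/2\rfloor}\mu(I)$. Denoting the pieces of $C_k(n)$ from left to right by $C_k^0(n),\dots,C_k^{a_k-1}(n)$, stack the $a_k$ resulting sub-columns from left (bottom) to right (top) and add on top $q_{k-1}$ new disjoint intervals (spacers), taken from $\mathbb{R}\setminus C_k$, all of the same length as the rightmost piece of the top level of $C_k$. Thus $C_{k+1}$ has $q_{k+1}=a_kq_k+q_{k-1}$ levels, with $C_{k+1}(jq_k+n)=C_k^j(n)$ for $0\le j<a_k$, $0\le n<q_k$, followed by the $q_{k-1}$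 spacers. Let $X$ be the union of all the columns, and let $T_{\alpha,\lambda}:X\to X$ map each non-top level of each $C_k$ to the level directly above it by the unique (orientation-preserving) affine map between them. $T_{\alpha,\lambda}$ is nonsingular, conservative and ergodic. Ratio set. For a nonsingular, conservative ergodic transformation $T$ of a $\sigma$-finite space $(X,\mu)$, let $\omega_n=\frac{d\mu\circ T^n}{d\mu}$. The ratio set $r(T)$ is the set of $t\ge 0$ such that for all $\epsilon>0$ and all measurable sets $A$ of positive measure there exists $n>0$ with $\mu(A\cap T^{-n}A\cap\{x:\omega_n(x)\in B_\epsilon(t)\})>0$, where $B_\epsilon(t)$ is the $\epsilon$-neighborhood of $t$. For $\lambda\in(0,1)$, $T$ is of type III$_\lambda$ if $r(T)=\{\lambda^n:n\in\mathbb{Z}\}\cup\{0\}$. *)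

(* Defs.v *)
From HB Require Import structures.
From mathcomp Require Import all_boot all_order all_algebra.
From mathcomp Require Import all_classical all_reals all_analysis.
Set Implicit Arguments.
Unset Strict Implicit.
Unset Printing Implicit Defensive.
Import Order.TTheory GRing.Theory Num.Theory.
Import numFieldNormedType.Exports.
Local Open Scope classical_set_scope.
Local Open Scope ring_scope.

(* Continued fraction expansion [a_0; a_1, a_2, ...]: complete quotients
   alpha_0 = alpha, alpha_(k+1) = 1 / (alpha_k - floor alpha_k), and partial
   quotients a_k = floor alpha_k. *)

Fixpoint complete_quotient (R : realType) (alpha : R) (k : nat) : R :=
  if k is k'.+1 then
    (complete_quotient alpha k' -
       (Num.floor (complete_quotient alpha k'))%:~R)^-1
  else alpha.

Definition partial_quotient (R : realType) (alpha : R) (k : nat) : int :=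
  Num.floor (complete_quotient alpha k).

(* The construction only uses a_k for k >= 1, which are positive when alpha is
   irrational, so the absolute value does not change them. *)
Definition cf_nat (R : realType) (alpha : R) (k : nat) : nat :=
  `|partial_quotient alpha k|%N.

Definition golden_type (R : realType) (alpha : R) : Prop :=
  exists n : nat, forall k : nat, (n <= k)%N -> partial_quotient alpha k = 1.

Fixpoint cf_q (a : nat -> nat) (k : nat) : nat :=
  match k with
  | 0 => 0
  | k1.+1 => match k1 with
             | 0 => 1
             | k2.+1 => a k1 * cf_q a k1 + cf_q a k2
             end
  end%N.

(* A level is coded as (left endpoint, length); column C k n is the n-th level
   from the bottom of the column C_k. *)

Definition level (R : realType) (I : R * R) : set R :=
  `]I.1, I.1 + I.2]%classic.

Definition piece_length (R : realType) (a : nat) (lambda : R) (I : R * R)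
    (j : nat) : R :=
  (if (j < uphalf a)%N then 1 else lambda) /
    ((uphalf a)%:R + lambda * (a./2)%:R) * I.2.

Definition piece (R : realType) (a : nat) (lambda : R) (I : R * R)
    (j : nat) : R * R :=
  (I.1 + \sum_(i < j) piece_length a lambda I i, piece_length a lambda I j).

(* The spacers may be placed anywhere off C_k: the positions of the q_(k-1)
   spacers are left unconstrained apart from the disjointness conditions. *)
Record column_construction (R : realType) (a : nat -> nat) (lambda : R)
    (C : nat -> nat -> R * R) : Prop := ColumnConstruction {
  column_one : C 1%N 0%N = (0, 1) ;
  column_cut : forall k j n : nat, (1 <= k)%N -> (j < a k)%N ->
    (n < cf_q a k)%N ->
    C k.+1 (j * cf_q a k + n)%N = piece (a k) lambda (C k n) j ;
  spacer_length : forall k i : nat, (1 <= k)%N -> (i < cf_q a k.-1)%N ->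
    (C k.+1 (a k * cf_q a k + i)%N).2 =
      (piece (a k) lambda (C k (cf_q a k).-1) (a k).-1).2 ;
  spacer_new : forall k i n : nat, (1 <= k)%N -> (i < cf_q a k.-1)%N ->
    (n < cf_q a k)%N ->
    level (C k.+1 (a k * cf_q a k + i)%N) `&` level (C k n) = set0 ;
  spacer_disjoint : forall k i j : nat, (1 <= k)%N ->
    (i < cf_q a k.-1)%N -> (j < cf_q a k.-1)%N -> i <> j ->
    level (C k.+1 (a k * cf_q a k + i)%N) `&`
      level (C k.+1 (a k * cf_q a k + j)%N) = set0 }.

Definition column_space (R : realType) (a : nat -> nat)
    (C : nat -> nat -> R * R) : set R :=
  \bigcup_(k in [set k | (1 <= k)%N])
    \bigcup_(n in [set n | (n < cf_q a k)%N]) level (C k n).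

(* T is determined on the column space only; its values elsewhere are
   irrelevant, as all the notions below are relative to a carrier X. *)
Definition column_map (R : realType) (a : nat -> nat)
    (C : nat -> nat -> R * R) (T : R -> R) : Prop :=
  forall (k n : nat) (x : R), (1 <= k)%N -> (n.+1 < cf_q a k)%N ->
    level (C k n) x ->
    T x = (C k n.+1).1 + (x - (C k n).1) / (C k n).2 * (C k n.+1).2.

(* Nonsingular systems (X, mu, T), where X is a measurable subset of an ambient
   measurable space S and only the restriction of T : S -> S to X matters. *)

Definition nonsingular d (S : measurableType d) (R : realType)
    (mu : {measure set S -> \bar R}) (X : set S) (T : S -> S) : Prop :=
  [/\ measurable X,
      set_bij X X T,
      measurable_fun X T,
      (forall A : set S, measurable A -> A `<=` X -> measurable (T @` A)) &
      forall A : set S, measurable A -> A `<=` X ->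
        (mu (T @` A) = 0%E <-> mu A = 0%E)].

Definition conservative d (S : measurableType d) (R : realType)
    (mu : {measure set S -> \bar R}) (X : set S) (T : S -> S) : Prop :=
  forall W : set S, measurable W -> W `<=` X ->
    trivIset setT (fun n : nat => X `&` iter n T @^-1` W) -> mu W = 0%E.

Definition ergodic d (S : measurableType d) (R : realType)
    (mu : {measure set S -> \bar R}) (X : set S) (T : S -> S) : Prop :=
  forall A : set S, measurable A -> A `<=` X -> X `&` T @^-1` A = A ->
    mu A = 0%E \/ mu (X `\` A) = 0%E.

(* The Radon-Nikodym derivative of the library is for charges, hence finite;
   mu \o T^n need not be finite on X. *)
Definition is_density d (S : measurableType d) (R : realType)
    (mu : {measure set S -> \bar R}) (X : set S) (nu : set S -> \bar R)
    (f : S -> R) : Prop :=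
  [/\ measurable_fun X f,
      (forall x, X x -> 0 <= f x) &
      forall A : set S, measurable A -> A `<=` X ->
        nu A = (\int[mu]_(x in A) (f x)%:E)%E].

(* omega_n = d(mu \o T^n) / dmu, chosen among its almost everywhere equal
   versions (junk value 0 if there is none). *)
Definition omega d (S : measurableType d) (R : realType)
    (mu : {measure set S -> \bar R}) (X : set S) (T : S -> S) (n : nat) :
    S -> R :=
  xget (cst 0) [set f | is_density mu X (fun A => mu (iter n T @` A)) f].

Definition ratio_set d (S : measurableType d) (R : realType)
    (mu : {sigma_finite_measure set S -> \bar R}) (X : set S) (T : S -> S) : set R :=
  [set t : R | 0 <= t /\
    forall (eps : R) (A : set S), 0 < eps -> measurable A -> A `<=` X ->
      (0 < mu A)%E ->
      exists n : nat, (0 < n)%N /\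
        (0 < mu (A `&` iter n T @^-1` A `&`
                 [set x : S | ball t eps (omega mu X T n x)]))%E].

Definition type_III d (S : measurableType d) (R : realType)
    (mu : {sigma_finite_measure set S -> \bar R}) (X : set S) (T : S -> S) (lambda : R) :
    Prop :=
  [/\ nonsingular mu X T, conservative mu X T, ergodic mu X T &
      ratio_set mu X T = [set lambda ^ n | n in [set: int]] `|` [set 0]].

(* Main.v *)
Require Import Defs.
From mathcomp Require Import all_boot all_order all_algebra.
From mathcomp Require Import all_classical all_reals all_analysis.
From mathcomp Require Import measurable_realfun ring lra zify.
Set Implicit Arguments.
Unset Strict Implicit.
Unset Printing Implicit Defensive.
Import Order.TTheory GRing.Theory Num.Theory.
Import numFieldNormedType.Exports.
Local Open Scope classical_set_scope.
Local Open Scope ring_scope.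

(** Within one column all lengths agree up to powers of lambda, because a cut
multiplies a length by a common factor and possibly by lambda, and a spacer
copies the length of a piece. On a level with at least n levels above it, the
n-th iterate of T is affine onto the level n steps higher, so its derivative
there is a ratio of lengths, hence a power of lambda. Spacers are added at every
stage from the second on, so these levels cover X for each n. The ratio set is
therefore contained in the powers of lambda together with their limit 0.

That alpha is not of golden type says that infinitely many stages cut their
levels into at least two pieces. Then the lengths of the levels tend to 0
([column_mesh]). As levels are open on the left, no point stays in the bottom
level forever, and T is onto X. The vanishing mesh also gives a density theorem
([mostly_in_levels]): for a set A of positive measure and delta > 0, every late
column has a level of which A misses at most the proportion delta. Ergodicity
follows by comparing, inside one late column, such a level for an invariant set
with one for its complement: an iterate of T carries one level affinely to the
other, so the two sets would overlap.

The main point is that every power of lambda is the derivative of a return to A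
at a positive time ([return_with_ratio]). Take two levels J and J' of a column,
both mostly in A, at a stage that really cuts. The pieces on the left half are
1/lambda times as long as those on the right half, relatively to their levels.
Averaging over corresponding pieces gives a left piece of J and a right piece of
J' that are both mostly in A, with delta multiplied by 6/lambda only, however
large the number of pieces ([mostly_in_split]); the ratio of the lengths gains a
factor lambda. Starting with J = J' and repeating this N times gives the ratio
lambda^N, and exchanging the two levels gives lambda^-N. A last split puts the
second level above the first. When delta is small enough at the start, the two
levels reached are mostly in A, so that a set of positive measure of points of A
in the first one returns to A in the second one. Conservativity is the case of
the ratio 1, and 0 belongs to the ratio set because it is a limit of powers. *)

(** * Partial quotients *)

Section continued_fraction.
Context {R : realType}.
Implicit Type alpha : R.

Lemma irrational_complete_quotient alpha k :
  irrational alpha -> irrational (complete_quotient alpha k).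
Proof.
move=> irr; elim: k => //= k IH [] r _ rE; apply: IH.
exists (r^-1 + (Num.floor (complete_quotient alpha k))%:~R) => //.
by rewrite rmorphD/= fmorphV/= ratr_int rE invrK subrK.
Qed.

Lemma complete_quotient_gt1 alpha k :
  irrational alpha -> (0 < k)%N -> 1 < complete_quotient alpha k.
Proof.
case: k => //= k irr _.
have := irrational_complete_quotient (k := k) irr.
set x := complete_quotient alpha k => xirr.
have x_lt : x - (Num.floor x)%:~R < 1.
  by rewrite ltrBlDl -intrD1 floorD1_gt.
have x_gt : 0 < x - (Num.floor x)%:~R.
  rewrite subr_gt0 lt_neqAle floor_le_tmp andbT.
  apply/eqP => xE; apply: xirr; exists (Num.floor x)%:~R => //.
  by rewrite ratr_int.
by rewrite invf_gt1.
Qed.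

Lemma partial_quotient_ge1 alpha k :
  irrational alpha -> (0 < k)%N -> 1 <= partial_quotient alpha k.
Proof.
move=> irr k0; rewrite /partial_quotient floor_ge_int_tmp.
exact/ltW/complete_quotient_gt1.
Qed.

Lemma cf_natE alpha k :
  irrational alpha -> (0 < k)%N -> (cf_nat alpha k)%:Z = partial_quotient alpha k.
Proof. by move=> irr k0; have := partial_quotient_ge1 irr k0; rewrite /cf_nat; lia. Qed.

Lemma cf_nat_gt0 alpha k : irrational alpha -> (0 < k)%N -> (0 < cf_nat alpha k)%N.
Proof. by move=> irr k0; have := partial_quotient_ge1 irr k0; rewrite -cf_natE//; lia. Qed.

Lemma not_golden_cf_nat_ge2 alpha : irrational alpha -> ~ golden_type alpha ->
  forall n, exists k, (n <= k)%N /\ (2 <= cf_nat alpha k)%N.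
Proof.
move=> irr ngold n; apply: contrapT => nk; apply: ngold.
exists n.+1 => k nltk; have k0 : (0 < k)%N by lia.
have := partial_quotient_ge1 irr k0; rewrite -(cf_natE irr k0).
have [?|?] := leqP 2 (cf_nat alpha k); last by lia.
by case: nk; exists k; split => //; lia.
Qed.

End continued_fraction.

(** * Heights of the columns *)

Section heights.
Variable a : nat -> nat.
Hypothesis a_gt0 : forall k, (0 < k)%N -> (0 < a k)%N.
Local Notation q := (cf_q a).

Lemma cf_qS k : (0 < k)%N -> q k.+1 = (a k * q k + q k.-1)%N.
Proof. by case: k. Qed.

Lemma cf_q_gt0 k : (0 < k)%N -> (0 < q k)%N.
Proof.
elim: k => // -[//|k] IH _; rewrite cf_qS// addn_gt0 muln_gt0 IH//.
by rewrite a_gt0.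
Qed.

Lemma piece_index_lt k j p :
  (0 < k)%N -> (j < a k)%N -> (p < q k)%N -> (j * q k + p < q k.+1)%N.
Proof. by move=> k0 ja pq; rewrite cf_qS//; nia. Qed.

(** Euclidean division by the height of C_k gives the rank of the subcolumn and
the position in it; indices beyond the subcolumns are those of the spacers. *)
Lemma cf_qSP k P : (0 < k)%N -> (P < q k.+1)%N ->
  (exists j p, [/\ (j < a k)%N, (p < q k)%N & P = (j * q k + p)%N]) \/
  (exists i, (i < q k.-1)%N /\ P = (a k * q k + i)%N).
Proof.
move=> k0; rewrite cf_qS// => Plt; have q0 := cf_q_gt0 k0.
have [Pa|aP] := ltnP P (a k * q k).
  left; exists (P %/ q k)%N, (P %% q k)%N; split.
  - by rewrite ltn_divLR.
  - exact: ltn_pmod.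
  - exact: divn_eq.
by right; exists (P - a k * q k)%N; split; lia.
Qed.

End heights.

(** * Affine maps between levels *)

Section affine_maps.
Context {R : realType}.
Local Notation mu := (@lebesgue_measure R).
Implicit Types (I J K : R * R) (A : set R) (x : R).

Definition level_map I J x : R := J.1 + (x - I.1) / I.2 * J.2.

Lemma level_mapK I J x : I.2 != 0 -> J.2 != 0 -> level_map J I (level_map I J x) = x.
Proof. by move=> I0 J0; rewrite /level_map; field; rewrite I0 J0. Qed.

Lemma level_map_comp I J K x :
  J.2 != 0 -> level_map J K (level_map I J x) = level_map I K x.
Proof.
move=> J0; rewrite /level_map (addrC J.1) addrK mulfK//.
Qed.

Lemma ltr_level_map I J x y : 0 < I.2 -> 0 < J.2 ->
  (level_map I J x < level_map I J y) = (x < y).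
Proof. by move=> I0 J0; rewrite ltrD2l ltr_pM2r// ltr_pM2r ?invr_gt0// ltrD2r. Qed.

Lemma ler_level_map I J x y : 0 < I.2 -> 0 < J.2 ->
  (level_map I J x <= level_map I J y) = (x <= y).
Proof. by move=> I0 J0; rewrite !leNgt ltr_level_map. Qed.

Lemma level_map_sub I J x : 0 < I.2 -> 0 < J.2 -> level I x -> level J (level_map I J x).
Proof.
rewrite /level /level_map /= !in_itv/= => I0 J0 /andP[Ix xI]; apply/andP; split.
  by rewrite ltrDl mulr_gt0// divr_gt0// subr_gt0.
by rewrite lerD2l ler_piMl ?(ltW J0)// ler_pdivrMr// mul1r lerBlDl.
Qed.

Lemma level_map_image I J A : I.2 != 0 -> J.2 != 0 ->
  level_map I J @` A = level_map J I @^-1` A.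
Proof.
move=> I0 J0; apply/seteqP; split => [_ [x Ax <-]|y Ay]; first by rewrite /= level_mapK.
by exists (level_map J I y) => //; rewrite level_mapK.
Qed.

Lemma measurable_level (I : R * R) : measurable (level I).
Proof. exact: measurable_itv. Qed.

Lemma measure_level I : 0 <= I.2 -> mu (level I) = I.2%:E.
Proof.
move=> I0; rewrite /level lebesgue_measure_itv/= lte_fin ltrDl.
case: ltP => [_|I0']; first by rewrite -EFinB addrC addKr.
by have -> : I.2 = 0 by apply/eqP; rewrite eq_le I0 I0'.
Qed.

Lemma measurable_level_map I J : measurable_fun setT (level_map I J).
Proof.
rewrite /level_map; apply: measurable_funD => //.
apply: measurable_funM => //; apply: measurable_funM => //.
exact: measurable_funB.
Qed.

Lemma measurable_level_map_image I J A : I.2 != 0 -> J.2 != 0 ->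
  measurable A -> measurable (level_map I J @` A).
Proof.
move=> I0 J0 mA; rewrite level_map_image// -[X in measurable X]setTI.
exact: measurable_level_map.
Qed.

(** A Borel measure is determined by its values on left-open right-closed
intervals, and on these both sides are a length multiplied by the slope. *)
Lemma measure_level_map_image I J A : 0 < I.2 -> 0 < J.2 -> measurable A ->
  mu (level_map I J @` A) = ((J.2 / I.2)%:E * mu A)%E.
Proof.
move=> I0 J0 mA; have I0' := lt0r_neq0 I0; have J0' := lt0r_neq0 J0.
have s0 : 0 <= I.2 / J.2 by rewrite ltW// divr_gt0.
pose nu : {measure set (measurableTypeR R) -> \bar R} :=
  mscale (NngNum s0) (pushforward mu (level_map J I : measurableTypeR R -> measurableTypeR R)).
have muE : forall B, measurable B -> mu B = nu (measurable_level_map J I) B.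
  apply: lebesgue_measure_unique => _ [[u v] /= uv] <-.
  rewrite /nu/= /mscale/= /pushforward.
  have -> : level_map J I @^-1` `]u, v] =
            `](level_map I J u), (level_map I J v)]%classic.
    apply/seteqP; split => x /=; rewrite !in_itv/= -(ltr_level_map u _ I0 J0);
      by rewrite -(ler_level_map _ v I0 J0) level_mapK.
  rewrite !lebesgue_measure_itv/= !lte_fin ltr_level_map//.
  case: ifP => _; last by rewrite mule0.
  by rewrite -!EFinB -EFinM; congr (_%:E); rewrite /level_map; field; rewrite I0' J0'.
rewrite (muE A)// /nu/= /mscale/= /pushforward muleA -EFinM.
have -> : J.2 / I.2 * (I.2 / J.2) = 1 by field; rewrite I0' J0'.
by rewrite mul1e level_map_image.
Qed.

End affine_maps.

(** * Cutting a level into pieces *)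

Section pieces.
Context {R : realType}.
Variables (a : nat) (lambda : R).
Hypotheses (lambda_gt0 : 0 < lambda) (a_gt0 : (0 < a)%N).
Implicit Types (I J : R * R).
Local Notation den := ((uphalf a)%:R + lambda * (a./2)%:R).

Lemma den_gt0 : 0 < den.
Proof. by rewrite ltr_pwDl ?ltr0n ?uphalf_gt0// mulr_ge0// ltW. Qed.

Lemma piece_length_gt0 I j : 0 < I.2 -> 0 < piece_length a lambda I j.
Proof.
move=> I0; rewrite /piece_length mulr_gt0// divr_gt0 ?den_gt0//.
by case: ifP.
Qed.

Lemma sum_piece_length I : \sum_(i < a) piece_length a lambda I i = I.2.
Proof.
have -> : \sum_(i < a) piece_length a lambda I i =
    (\sum_(i < a) if (i < uphalf a)%N then 1 else lambda) / den * I.2.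
  by rewrite 2!big_distrl.
suff -> : \sum_(i < a) (if (i < uphalf a)%N then 1 else lambda) = den.
  by rewrite divff ?mul1r// gt_eqF// den_gt0.
rewrite -(big_mkord xpredT (fun i => if (i < uphalf a)%N then 1 else lambda)).
rewrite (@big_cat_nat _ _ _ (uphalf a))//=; last by lia.
congr (_ + _).
  under eq_big_nat => i /andP[_ ->] do [].
  by rewrite big_const_nat iter_addr_0 subn0.
rewrite big_nat_cond (eq_bigr (fun=> lambda)); last first.
  by move=> i; rewrite andbT => /andP[h _]; rewrite ltnNge h.
rewrite -big_nat_cond big_const_nat iter_addr_0 mulr_natr.
by congr (_ *+ _); lia.
Qed.

Lemma partial_length_le I m n : 0 < I.2 -> (m <= n)%N ->
  \sum_(i < m) piece_length a lambda I i <= \sum_(i < n) piece_length a lambda I i.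
Proof.
move=> I0 mn; rewrite -!(big_mkord xpredT (piece_length a lambda I)).
rewrite [leRHS](@big_cat_nat _ _ _ m)//= lerDl sumr_ge0// => i _.
exact/ltW/piece_length_gt0.
Qed.

Lemma piece_end I j : (piece a lambda I j).1 + (piece a lambda I j).2 =
  I.1 + \sum_(i < j.+1) piece_length a lambda I i.
Proof. by rewrite /piece/= big_ord_recr/= addrA. Qed.

Lemma piece_sub I j : 0 < I.2 -> (j < a)%N ->
  level (piece a lambda I j) `<=` level I.
Proof.
move=> I0 ja x; rewrite /level /= !in_itv/= piece_end => /andP[xl xr]; apply/andP; split.
  by apply: le_lt_trans xl; rewrite lerDl sumr_ge0// => i _; exact/ltW/piece_length_gt0.
apply: (le_trans xr); rewrite lerD2l -[leRHS]sum_piece_length.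
exact: partial_length_le.
Qed.

Lemma piece_disjoint I i j x : 0 < I.2 ->
  level (piece a lambda I i) x -> level (piece a lambda I j) x -> i = j.
Proof.
wlog ij : i j / (i < j)%N.
  move=> wl I0 xi xj; have [ij|ji|//] := ltngtP i j; first exact: wl.
  exact/esym/wl.
move=> I0; rewrite /level /= !in_itv/= !piece_end => /andP[_ x1] /andP[x2 _].
suff : x < x by rewrite ltxx.
by apply: (le_lt_trans x1); apply: le_lt_trans x2; rewrite lerD2l partial_length_le.
Qed.

Lemma level_pieces I x : level I x ->
  exists2 j, (j < a)%N & level (piece a lambda I j) x.
Proof.
rewrite /level/= in_itv/= => /andP[xl xr].
have : exists j, x <= I.1 + \sum_(i < j) piece_length a lambda I i.
  by exists a; rewrite sum_piece_length.
move=> exj; case: (ex_minnP exj) => -[|j] xj minj.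
  by move: xj; rewrite big_ord0 addr0 leNgt xl.
exists j; first by apply: minj; rewrite sum_piece_length.
rewrite /= in_itv/= piece_end xj andbT ltNge.
by apply/negP => /minj; rewrite ltnn.
Qed.

Lemma piece_ratio I J j : 0 < I.2 -> 0 < J.2 ->
  (piece a lambda J j).2 / (piece a lambda I j).2 = J.2 / I.2.
Proof.
move=> I0 J0; have d0 := den_gt0; rewrite /piece/= /piece_length.
by case: ifP => _; field; rewrite !gt_eqF.
Qed.

Hypothesis lambda_lt1 : lambda < 1.

Lemma piece_length_le I j : 0 < I.2 -> (piece a lambda I j).2 <= I.2.
Proof.
move=> I0; have l1 := lambda_lt1.
rewrite /piece/= /piece_length ler_piMl ?(ltW I0)//.
rewrite ler_pdivrMr ?den_gt0// mul1r.
have : (1 : R) <= (uphalf a)%:R by rewrite ler1n uphalf_gt0.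
have : 0 <= lambda * (a./2)%:R by rewrite mulr_ge0// ltW.
move: (lambda * (a./2)%:R) (uphalf a)%:R => v u v0 u1.
by case: ifP => _; lra.
Qed.

Lemma piece_length_contract I j : 0 < I.2 -> (1 < a)%N ->
  (piece a lambda I j).2 <= (1 + lambda)^-1 * I.2.
Proof.
move=> I0 a2; have l0 := lambda_gt0; have l1 := lambda_lt1.
rewrite /piece/= /piece_length ler_wpM2r ?(ltW I0)//.
rewrite ler_pdivrMr ?den_gt0// ler_pdivlMl; last lra.
have : (1 : R) <= (uphalf a)%:R by rewrite ler1n uphalf_gt0.
have : (1 : R) <= (a./2)%:R by rewrite ler1n half_gt0.
move: (a./2)%:R (uphalf a)%:R => v u v1 u1.
by case: ifP => _; nra.
Qed.

End pieces.

(** * Finite sums and averages *)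

Section averages.
Context {R : realType}.

Lemma sum_sub_measure d (S : measurableType d) (mu : {measure set S -> \bar R})
    h B (F : nat -> set S) : measurable B ->
  (forall j, (j < h)%N -> measurable (F j) /\ F j `<=` B) ->
  (forall i j x, (i < h)%N -> (j < h)%N -> F i x -> F j x -> i = j) ->
  (\sum_(j < h) mu (F j) <= mu B)%E.
Proof.
move=> mB FB Fdisj; have mF (j : 'I_h) : measurable (F j) by have [] := FB j.
rewrite -(measure_bigsetU_ord mu xpredT (F := fun j : 'I_h => F j))//; last first.
  by move=> i j _ _ [x [xi xj]]; apply/val_inj; exact: (Fdisj _ _ x (ltn_ord i) (ltn_ord j)).
apply: le_measure; rewrite ?inE//; first by apply: bigsetU_measurable => j _; exact: mF.
rewrite -(bigcup_mkord _ F) => x [j /= jh].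
by have [_] := FB j jh; apply.
Qed.

(** The numbers u j / U + v j / V have an average of at most 2 / h. *)
Lemma exists_two_averages h (u v : nat -> R) (U V : R) : (0 < h)%N -> 0 < U -> 0 < V ->
  (forall j, 0 <= u j) -> (forall j, 0 <= v j) ->
  \sum_(j < h) u j <= U -> \sum_(j < h) v j <= V ->
  exists2 j, (j < h)%N & u j <= 2 * U / h%:R /\ v j <= 2 * V / h%:R.
Proof.
move=> h0 U0 V0 u0 v0 uU vV; have hR : 0 < h%:R :> R by rewrite ltr0n.
have [j jh] : exists2 j, (j < h)%N & u j / U + v j / V <= 2 / h%:R.
  apply: contrapT => none.
  have : \sum_(j < h) (u j / U + v j / V) <= 2.
    rewrite big_split/= -!mulr_suml.
    have : (\sum_(j < h) u j) / U <= 1 by rewrite ler_pdivrMr// mul1r.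
    have : (\sum_(j < h) v j) / V <= 1 by rewrite ler_pdivrMr// mul1r.
    by move: (_ / V) (_ / U) => x y; lra.
  rewrite leNgt => /negP; apply.
  have -> : 2 = \sum_(j < h) (2 / h%:R) :> R.
    by rewrite sumr_const card_ord -[RHS]mulr_natr divfK// gt_eqF.
  apply: ltr_sum; first by apply/hasP; exists (Ordinal h0); rewrite ?mem_index_enum.
  move=> j _; rewrite ltNge; apply/negP => le.
  by apply: none; exists j.
move=> le; exists j => //; have uj : 0 <= u j / U by rewrite divr_ge0// ltW.
have vj : 0 <= v j / V by rewrite divr_ge0// ltW.
split.
  have : u j / U <= 2 / h%:R by lra.
  by rewrite ler_pdivrMr// mulrAC.
have : v j / V <= 2 / h%:R by lra.
by rewrite ler_pdivrMr// mulrAC.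
Qed.

End averages.

(** * Columns *)

Section construction.
Context {R : realType}.
Variables (a : nat -> nat) (lambda : R) (C : nat -> nat -> R * R) (T : R -> R).
Hypotheses (a_gt0 : forall k, (0 < k)%N -> (0 < a k)%N)
  (a_ge2 : forall n, exists k, (n <= k)%N /\ (2 <= a k)%N)
  (lambda_gt0 : 0 < lambda) (lambda_lt1 : lambda < 1)
  (col : column_construction a lambda C) (colT : column_map a C T).
Local Notation q := (cf_q a).
Local Notation lev k p := (level (C k p)).
Local Notation X := (column_space a C).

Lemma q_gt0 k : (0 < k)%N -> (0 < q k)%N.
Proof. exact: cf_q_gt0. Qed.

Lemma column_length_gt0 k p : (0 < k)%N -> (p < q k)%N -> 0 < (C k p).2.
Proof.
elim: k p => // -[_ [_ _|//]|k IH p _ pq]; first by rewrite (column_one col).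
case: (cf_qSP a_gt0 _ pq) => // -[].
  move=> j [n [ja nq ->]]; rewrite (column_cut col)//.
  exact: piece_length_gt0 (a_gt0 _) _ _ (IH _ _ _).
move=> i [iq ->]; rewrite (spacer_length col)//.
apply: piece_length_gt0 => //; first exact: a_gt0.
by apply: IH => //; rewrite prednK// q_gt0.
Qed.

Lemma subcolumn_sub k j p : (0 < k)%N -> (j < a k)%N -> (p < q k)%N ->
  lev k.+1 (j * q k + p) `<=` lev k p.
Proof.
move=> k0 ja pq; rewrite (column_cut col)//.
by apply: piece_sub => //; [exact: a_gt0|exact: column_length_gt0].
Qed.

Lemma column_refine k p x : (0 < k)%N -> (p < q k)%N -> lev k p x ->
  exists2 j, (j < a k)%N & lev k.+1 (j * q k + p) x.
Proof.
move=> k0 pq xp; have [j ja xj] := level_pieces lambda_gt0 (a_gt0 k0) xp.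
by exists j => //; rewrite (column_cut col).
Qed.

Lemma column_disjoint k p p' x : (0 < k)%N -> (p < q k)%N -> (p' < q k)%N ->
  lev k p x -> lev k p' x -> p = p'.
Proof.
elim: k p p' => // -[_ [|//] [|//]//|k IH p p' _ pq pq' xp xp'].
have k0 : (0 < k.+1)%N by [].
have [[j [n [ja nq pE]]]|[i [iq pE]]] := cf_qSP a_gt0 k0 pq;
  have [[j' [n' [ja' nq' pE']]]|[i' [iq' pE']]] := cf_qSP a_gt0 k0 pq'.
- move: xp xp'; rewrite pE pE' => xp xp'.
  have nn : n = n'.
    by apply: IH => //; [exact: subcolumn_sub xp|exact: subcolumn_sub xp'].
  move: xp xp'; rewrite -nn !(column_cut col)// => xp xp'.
  have l0 := column_length_gt0 k0 nq.
  by rewrite (piece_disjoint lambda_gt0 (a_gt0 k0) l0 xp xp').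
- move: xp xp'; rewrite pE pE' => /(subcolumn_sub k0 ja nq) xp xp'.
  have := spacer_new col k0 iq' nq; rewrite predeqE => /(_ x)[+ _].
  by case.
- move: xp xp'; rewrite pE pE' => xp /(subcolumn_sub k0 ja' nq') xp'.
  have := spacer_new col k0 iq nq'; rewrite predeqE => /(_ x)[+ _].
  by case.
- move: xp xp'; rewrite pE pE'; have [-> //|ii'] := eqVneq i i' => xp xp'.
  have := spacer_disjoint col k0 iq iq' (elimN eqP ii').
  by rewrite predeqE => /(_ x)[+ _]; case.
Qed.

(** Every cut divides lengths by a common factor and then multiplies them by 1
or lambda, and spacers copy the length of a piece. *)
Lemma column_length_ratio k p p' : (0 < k)%N -> (p < q k)%N -> (p' < q k)%N ->
  exists m : int, (C k p').2 / (C k p).2 = lambda ^ m.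
Proof.
suff H : forall k, (0 < k)%N -> exists2 c : R, c != 0 &
    forall p, (p < q k)%N -> exists m : int, (C k p).2 = c * lambda ^ m.
  move=> k0 pq pq'; have [c c0 Hc] := H k k0.
  have [m ->] := Hc _ pq; have [m' ->] := Hc _ pq'.
  exists (m' - m); rewrite expfzDr ?gt_eqF// -invr_expz; field.
  by rewrite c0 expfz_neq0// gt_eqF.
clear k p p'; elim=> // -[_ _|k /(_ isT)[c c0 IH] _].
  exists 1; rewrite ?oner_neq0// => -[|//] _; exists 0.
  by rewrite (column_one col)/= expr0z mul1r.
have k0 : (0 < k.+1)%N by [].
set ak := a k.+1; pose den : R := (uphalf ak)%:R + lambda * (ak./2)%:R.
have den0 : den != 0 by rewrite gt_eqF// den_gt0// a_gt0.
have Hpiece p j : (p < q k.+1)%N ->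
    exists m : int, (piece ak lambda (C k.+1 p) j).2 = c / den * lambda ^ m.
  move=> pq; have [m /= mE] := IH _ pq; rewrite /piece/= /piece_length mE -/den.
  case: ifP => _; first by exists m; field.
  by exists (1 + m); rewrite expfzDr ?gt_eqF// expr1z; field.
exists (c / den); first by rewrite mulf_neq0// invr_neq0.
move=> P Pq; case: (cf_qSP a_gt0 k0 Pq) => -[].
  by move=> j [p [ja pq ->]]; rewrite (column_cut col)//; exact: Hpiece.
move=> i [iq ->]; rewrite (spacer_length col)//; apply: Hpiece.
by rewrite prednK// q_gt0.
Qed.

(** Lengths never increase and are divided by at least 1 + lambda at each of the
infinitely many stages that really cut. *)
Lemma column_length_bound N :
  exists2 K, (0 < K)%N & forall k, (K <= k)%N -> forall p, (p < q k)%N ->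
    (C k p).2 <= (1 + lambda)^-1 ^+ N.
Proof.
have l0 := lambda_gt0; pose B k b := forall p, (p < q k)%N -> (C k p).2 <= b.
have step k b c : (0 < k)%N -> B k b ->
    (forall p j, (p < q k)%N -> (piece (a k) lambda (C k p) j).2 <= c * (C k p).2) ->
    0 <= c -> B k.+1 (c * b).
  move=> k0 Bkb Hc c0 P /(cf_qSP a_gt0 k0)[[j [p [ja pq ->]]]|[i [iq ->]]].
    rewrite (column_cut col)//; apply: (le_trans (Hc _ _ pq)).
    by rewrite ler_wpM2l// Bkb.
  rewrite (spacer_length col)//.
  have pq : ((q k).-1 < q k)%N by rewrite prednK// q_gt0.
  by apply: (le_trans (Hc _ _ pq)); rewrite ler_wpM2l// Bkb.
have keep k k' b : (0 < k)%N -> (k <= k')%N -> B k b -> B k' b.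
  move=> k0; elim: k' => [|k' IH]; first by rewrite leqn0 => /eqP ->.
  rewrite leq_eqVlt => /orP[/eqP <- //|kk'] Bb; rewrite -[b]mul1r.
  have k'0 : (0 < k')%N by lia.
  apply: step => //; first exact: IH.
  move=> p j pq; rewrite mul1r; apply: piece_length_le => //; first exact: a_gt0.
  exact: column_length_gt0.
elim: N => [|N [K K0 IH]].
  by exists 1%N => // k k0; apply: keep k0 _ => // -[|//] _; rewrite (column_one col).
have [k [Kk ak]] := a_ge2 K; have k0 : (0 < k)%N by exact: leq_trans Kk.
exists k.+1 => // k' kk'; apply: keep kk' _ => //.
rewrite exprS; apply: step => //; first exact: IH.
  move=> p j pq; apply: piece_length_contract => //; first exact: a_gt0.
  exact: column_length_gt0.
by rewrite invr_ge0; lra.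
Qed.

Lemma column_mesh eps : 0 < eps ->
  exists2 K, (0 < K)%N & forall k p, (K <= k)%N -> (p < q k)%N -> (C k p).2 < eps.
Proof.
move=> eps0; have l0 := lambda_gt0.
have r1 : `|(1 + lambda)^-1| < 1.
  by rewrite ger0_norm ?invr_ge0 ?invf_lt1; lra.
have := cvg_expr r1 => /cvgrPdist_lt/(_ _ eps0)[N _ /(_ N (leqnn N))/=].
rewrite sub0r normrN => Neps; have [K K0 HK] := column_length_bound N.
exists K => // k p Kk pq; apply: le_lt_trans (HK _ Kk _ pq) _.
exact: le_lt_trans (ler_norm _) Neps.
Qed.

Lemma column_lift k k' p x : (0 < k)%N -> (k <= k')%N -> (p < q k)%N -> lev k p x ->
  exists2 p', (p' < q k')%N & lev k' p' x.
Proof.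
move=> k0 + pq xp; elim: k' => [|k' IH]; first by rewrite leqn0 => /eqP <-; exists p.
rewrite leq_eqVlt => /orP[/eqP <-|kk']; first by exists p.
have [//|p' pq' xp'] := IH; have k'0 : (0 < k')%N by lia.
have [j ja xj] := column_refine k'0 pq' xp'.
by exists (j * q k' + p')%N => //; exact: piece_index_lt.
Qed.

(** * Iterates of the map on the levels *)

Lemma iter_level_map k p n x : (0 < k)%N -> (p + n < q k)%N -> lev k p x ->
  iter n T x = level_map (C k p) (C k (p + n)) x.
Proof.
move=> k0; elim: n => [|n IH] pnq xp.
  have l0 := column_length_gt0 k0 pnq.
  by move: l0; rewrite addn0 => l0; rewrite /level_map/=; field; rewrite gt_eqF.
have pnq' : (p + n < q k)%N by lia.
have l0 : 0 < (C k p).2 by apply: column_length_gt0 => //; lia.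
have l0' := column_length_gt0 k0 pnq'.
have xpn : lev k (p + n) (level_map (C k p) (C k (p + n)) x) by exact: level_map_sub.
rewrite addnS in pnq *; rewrite /= IH// (colT k0 pnq xpn).
by rewrite -/(level_map _ _ _) level_map_comp// gt_eqF.
Qed.

Lemma iter_level k p n x : (0 < k)%N -> (p + n < q k)%N -> lev k p x ->
  lev k (p + n) (iter n T x).
Proof.
move=> k0 pnq xp; rewrite (iter_level_map k0 pnq xp).
by apply: level_map_sub => //; apply: column_length_gt0 => //; lia.
Qed.

Lemma column_spaceP k p x : (0 < k)%N -> (p < q k)%N -> lev k p x -> X x.
Proof. by move=> k0 pq xp; exists k => //; exists p. Qed.

(** The spacers put on top of the next column give every point one more level
above it. *)
Lemma column_space_height n K x : X x ->
  exists k p, [/\ (K <= k)%N, (0 < k)%N, (p + n < q k)%N & lev k p x].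
Proof.
move=> [k0 k0_gt0 [p0 /= pq0 xp0]].
suff [k [p [kK pnq xp]]] : exists k p,
    [/\ (maxn K 2 <= k)%N, (p + n < q k)%N & lev k p x].
  by exists k, p; split => //; lia.
elim: n => [|n [k [p [kK pnq xp]]]].
  have [|p pq xp] := column_lift (k' := maxn k0 (maxn K 2)) k0_gt0 _ pq0 xp0.
    by lia.
  by exists (maxn k0 (maxn K 2)), p; rewrite addn0; split => //; lia.
have kp : (0 < k)%N by lia.
have pq : (p < q k)%N by lia.
have [j ja xj] := column_refine kp pq xp.
exists k.+1, (j * q k + p)%N; split => //; first by lia.
have : (0 < q k.-1)%N by apply: cf_q_gt0 => //; lia.
by rewrite cf_qS//; nia.
Qed.

Definition level_ratio n k p : R := (C k (p + n)).2 / (C k p).2.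

(** Pieces of the same rank of two levels are in the same ratio as the levels, so
the ratio seen at x does not change from one column to the next. *)
Lemma level_ratio_lift k k' p n x : (0 < k)%N -> (k <= k')%N ->
  (p + n < q k)%N -> lev k p x ->
  exists p', [/\ (p' + n < q k')%N, lev k' p' x & level_ratio n k' p' = level_ratio n k p].
Proof.
move=> k0 + pnq xp; elim: k' => [|k' IH].
  by rewrite leqn0 => /eqP kE; rewrite kE in k0.
rewrite leq_eqVlt => /orP[/eqP <-|kk']; first by exists p.
have [//|p' [pnq' xp' rE]] := IH; have k'0 : (0 < k')%N by lia.
have pq' : (p' < q k')%N by lia.
have [j ja xj] := column_refine k'0 pq' xp'.
exists (j * q k' + p')%N; split => //.
  by rewrite -addnA; apply: piece_index_lt.
rewrite -rE /level_ratio -addnA !(column_cut col)//.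
by apply: (piece_ratio lambda_gt0 (a_gt0 k'0)); apply: column_length_gt0 => //; lia.
Qed.

Lemma level_ratio_unique n k k' p p' x : (0 < k)%N -> (0 < k')%N ->
  (p + n < q k)%N -> (p' + n < q k')%N -> lev k p x -> lev k' p' x ->
  level_ratio n k p = level_ratio n k' p'.
Proof.
move=> k0 k'0 pnq pnq' xp xp'; pose m := maxn k k'.
have [|p1 [pq1 x1 <-]] := level_ratio_lift (k' := m) k0 _ pnq xp; first by lia.
have [|p2 [pq2 x2 <-]] := level_ratio_lift (k' := m) k'0 _ pnq' xp'; first by lia.
suff -> : p1 = p2 by [].
by apply: (column_disjoint _ _ _ x1 x2); lia.
Qed.

Lemma iter_column_space n x : X x -> X (iter n T x).
Proof.
move=> /(column_space_height n 0)[k [p [_ k0 pnq xp]]].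
by apply: (column_spaceP k0 pnq); exact: iter_level.
Qed.

Lemma iter_column_inj n x y : X x -> X y -> iter n T x = iter n T y -> x = y.
Proof.
move=> /(column_space_height n 0)[k [p [_ k0 pnq xp]]].
move=> /(column_space_height n 0)[k' [p' [_ k'0 pnq' yp']]] xy.
pose m := maxn k k'; have m0 : (0 < m)%N by lia.
have [|p1 [pq1 x1 _]] := level_ratio_lift (k' := m) k0 _ pnq xp; first by lia.
have [|p2 [pq2 y2 _]] := level_ratio_lift (k' := m) k'0 _ pnq' yp'; first by lia.
have Tx := iter_level m0 pq1 x1; have Ty := iter_level m0 pq2 y2.
have p12 : p1 = p2.
  apply/eqP; rewrite -(eqn_add2r n); apply/eqP.
  by rewrite xy in Tx; exact: (column_disjoint _ _ _ Tx Ty).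
move: xy; rewrite (iter_level_map m0 pq1 x1) p12.
rewrite (iter_level_map m0 pq2 y2); move=> /(congr1 (level_map (C m (p2 + n)) (C m p2))).
have l0 : (C m p2).2 != 0.
  by rewrite gt_eqF// column_length_gt0//; lia.
have l0' : (C m (p2 + n)).2 != 0.
  by rewrite gt_eqF// column_length_gt0//; lia.
by rewrite !level_mapK.
Qed.

Lemma bottom_left_end k : (0 < k)%N -> (C k 0%N).1 = 0.
Proof.
elim: k => // -[_ _|k /(_ isT) IH _]; first by rewrite (column_one col).
have := column_cut col (k := k.+1) (j := 0) (n := 0) isT (a_gt0 _) (cf_q_gt0 a_gt0 _).
by rewrite mul0n addn0 => -> //=; rewrite big_ord0 addr0 IH.
Qed.

(** A point that stayed in the bottom level of every column would be positive
and at most the length of these levels, which tends to 0: this uses that levels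
are open on the left. *)
Lemma column_map_surj y : X y -> exists2 x, X x & T x = y.
Proof.
move=> Xy; suff [k [p [k0 pq yp]]] : exists k p,
    [/\ (0 < k)%N, (p.+1 < q k)%N & lev k p.+1 y].
  have l0 : 0 < (C k p).2 by apply: column_length_gt0 => //; lia.
  have l1 := column_length_gt0 k0 pq.
  have xp : lev k p (level_map (C k p.+1) (C k p) y) by exact: level_map_sub.
  exists (level_map (C k p.+1) (C k p) y); first by apply: column_spaceP k0 _ xp; lia.
  have := iter_level_map (n := 1) k0 _ xp; rewrite addn1 => /(_ pq)/= ->.
  by rewrite level_mapK ?gt_eqF.
apply: contrapT => bottom.
have {}bottom k p : (0 < k)%N -> (p < q k)%N -> lev k p y -> p = 0%N.
  by case: p => // p k0 pq yp; case: bottom; exists k, p.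
have y0 : 0 < y.
  have [k [p [_ k0 pq yp]]] := column_space_height 0 0 Xy.
  rewrite addn0 in pq; have pE := bottom _ _ k0 pq yp.
  by move: yp; rewrite pE /level/= in_itv/= bottom_left_end// => /andP[].
have [K K0 HK] := column_mesh y0.
have [k [p [Kk k0 pq yp]]] := column_space_height 0 K Xy.
rewrite addn0 in pq; have := HK _ _ Kk pq.
have pE := bottom _ _ k0 pq yp; move: yp.
rewrite pE /level/= in_itv/= bottom_left_end// add0r => /andP[_ yle].
by rewrite ltNge yle.
Qed.

(** The levels on which the n-th iterate is affine, enumerated by the codes of
pairs so that countable unions and sums over them are indexed by nat. *)
Definition height_cover n (i : nat) : set R :=
  if unpickle i is Some (k, p) then
    if (0 < k)%N && (p + n < q k)%N then lev k p else set0
  else set0.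

Lemma height_coverP n i : height_cover n i = set0 \/
  exists k p, [/\ (0 < k)%N, (p + n < q k)%N & height_cover n i = lev k p].
Proof.
rewrite /height_cover; case: unpickle => [[k p]|]; last by left.
by case: ifP => [/andP[k0 pnq]|_]; [right; exists k, p|left].
Qed.

Lemma bigcup_height_cover n : \bigcup_i height_cover n i = X.
Proof.
apply/seteqP; split => [x [i _]|x /(column_space_height n 0)[k [p [_ k0 pnq xp]]]].
  have [->//|[k [p [k0 pnq ->]]]] := height_coverP n i.
  by move=> xp; apply: (column_spaceP k0 _ xp); lia.
by exists (pickle (k, p)) => //; rewrite /height_cover pickleK k0 pnq.
Qed.

Lemma measurable_height_cover n i : measurable (height_cover n i).
Proof.
have [->//|[k [p [k0 pnq ->]]]] := height_coverP n i.
exact: measurable_level.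
Qed.

Lemma measurable_column_space : measurable X.
Proof.
rewrite -(bigcup_height_cover 0); apply: bigcupT_measurable => i.
exact: measurable_height_cover.
Qed.

(** * Nonsingularity and the derivatives of the iterates *)

Local Notation mu := (@lebesgue_measure R).

Lemma eq_iter_level_map k p n A : (0 < k)%N -> (p + n < q k)%N -> A `<=` lev k p ->
  iter n T @` A = level_map (C k p) (C k (p + n)) @` A.
Proof.
move=> k0 pnq Ap; apply: eq_imagel => x Ax.
by apply: iter_level_map => //; exact: Ap.
Qed.

Lemma measurable_iter_level k p n A : (0 < k)%N -> (p + n < q k)%N ->
  measurable A -> A `<=` lev k p -> measurable (iter n T @` A).
Proof.
move=> k0 pnq mA Ap; rewrite (eq_iter_level_map k0 pnq Ap).
by apply: measurable_level_map_image => //; rewrite gt_eqF// column_length_gt0//; lia.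
Qed.

Lemma measure_iter_level k p n A : (0 < k)%N -> (p + n < q k)%N ->
  measurable A -> A `<=` lev k p ->
  mu (iter n T @` A) = ((level_ratio n k p)%:E * mu A)%E.
Proof.
move=> k0 pnq mA Ap; rewrite (eq_iter_level_map k0 pnq Ap).
by apply: measure_level_map_image => //; apply: column_length_gt0 => //; lia.
Qed.

Lemma level_ratio_gt0 n k p : (0 < k)%N -> (p + n < q k)%N -> 0 < level_ratio n k p.
Proof. by move=> k0 pnq; rewrite divr_gt0//; apply: column_length_gt0 => //; lia. Qed.

Lemma measurable_iter n : measurable_fun X (iter n T).
Proof.
rewrite -(bigcup_height_cover n).
apply: (measurable_fun_bigcup _ (measurable_height_cover n)).2 => i.
have [->|[k [p [k0 pnq ->]]]] := height_coverP n i; first exact: measurable_fun_set0.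
apply: (@eq_measurable_fun _ _ _ _ _ (level_map (C k p) (C k (p + n)))).
  by move=> x /[!inE] xp; rewrite (iter_level_map k0 pnq xp).
by apply: measurable_funTS; exact: measurable_level_map.
Qed.

(** For A contained in X, a countable partition of A: it reduces statements that
are sigma-additive in A to the case of a single level. *)
Definition height_part n A i := seqDU (height_cover n) i `&` A.

Lemma bigcup_height_part n A : A `<=` X -> \bigcup_i height_part n A i = A.
Proof.
move=> AX; rewrite -setI_bigcupl -seqDU_bigcup_eq bigcup_height_cover.
exact/setIidr.
Qed.

Lemma trivIset_height_part n A : trivIset setT (height_part n A).
Proof. by apply: trivIset_setIr; exact: trivIset_seqDU. Qed.

Lemma measurable_height_part n A i : measurable A -> measurable (height_part n A i).
Proof.
move=> mA; apply: measurableI => //; apply: seqDU_measurable => j.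
exact: measurable_height_cover.
Qed.

Lemma height_partP n A i : height_part n A i = set0 \/
  exists k p, [/\ (0 < k)%N, (p + n < q k)%N & height_part n A i `<=` lev k p].
Proof.
have sub : height_part n A i `<=` height_cover n i.
  by move=> x [xi _]; exact: subset_seqDU xi.
have [E|[k [p [k0 pnq E]]]] := height_coverP n i.
  by left; rewrite -subset0 -E.
by right; exists k, p; rewrite -E.
Qed.

Lemma height_part_sub n A i : height_part n A i `<=` A.
Proof. by move=> x []. Qed.

Lemma measurable_iter_image n A : measurable A -> A `<=` X -> measurable (iter n T @` A).
Proof.
move=> mA AX; rewrite -(bigcup_height_part n AX) image_bigcup.
apply: bigcupT_measurable => i.
have [->|[k [p [k0 pnq sub]]]] := height_partP n A i; first by rewrite image_set0.
by apply: measurable_iter_level sub => //; exact: measurable_height_part.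
Qed.

Lemma null_of_null_levels n A : measurable A -> A `<=` X ->
  (forall k p, (0 < k)%N -> (p + n < q k)%N -> mu (A `&` lev k p) = 0%E) -> mu A = 0%E.
Proof.
move=> mA AX null; rewrite -(bigcup_height_part n AX).
rewrite measure_semi_bigcup; last 3 first.
- by move=> i; exact: measurable_height_part.
- exact: trivIset_height_part.
- by rewrite bigcup_height_part.
apply: eseries0 => i _ _.
have [->|[k [p [k0 pnq sub]]]] := height_partP n A i; first by rewrite measure0.
apply: subset_measure0 (null k p k0 pnq).
- exact: measurable_height_part.
- by apply: measurableI => //; exact: measurable_level.
- by move=> x xi; split; [exact: height_part_sub xi|exact: sub].
Qed.

(** The derivative of the n-th iterate. A point lies in admissible levels of
many columns; they all give the same ratio by [level_ratio_unique]. *)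
Definition iter_density n (x : R) : R := xget 0
  [set r | exists k p, [/\ (0 < k)%N, (p + n < q k)%N, lev k p x & r = level_ratio n k p]].

Lemma iter_densityE n k p x : (0 < k)%N -> (p + n < q k)%N -> lev k p x ->
  iter_density n x = level_ratio n k p.
Proof.
move=> k0 pnq xp; rewrite /iter_density; case: xgetP => [_ -> [k' [p' [k'0 pnq' xp' ->]]]|].
  exact: level_ratio_unique xp' xp.
by move=> /(_ (level_ratio n k p)); case; exists k, p.
Qed.

Lemma iter_density_ge0 n x : X x -> 0 <= iter_density n x.
Proof.
move=> /(column_space_height n 0)[k [p [_ k0 pnq xp]]].
by rewrite (iter_densityE k0 pnq xp) ltW// level_ratio_gt0.
Qed.

Lemma measurable_iter_density n : measurable_fun X (iter_density n).
Proof.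
rewrite -(bigcup_height_cover n).
apply: (measurable_fun_bigcup _ (measurable_height_cover n)).2 => i.
have [->|[k [p [k0 pnq ->]]]] := height_coverP n i; first exact: measurable_fun_set0.
apply: (@eq_measurable_fun _ _ _ _ _ (cst (level_ratio n k p))); last exact: measurable_cst.
by move=> x /[!inE] xp; rewrite (iter_densityE k0 pnq xp).
Qed.

(** Both sides are sigma-additive in A, and T^n is affine on each of the levels
that cover X. *)
Lemma is_density_iter n : is_density mu X (fun A => mu (iter n T @` A)) (iter_density n).
Proof.
split; [exact: measurable_iter_density|exact: iter_density_ge0|].
move=> A mA AX.
have mP i : measurable (height_part n A i) by exact: measurable_height_part.
have PX i : height_part n A i `<=` X by apply: subset_trans AX; exact: height_part_sub.
have mf D : measurable D -> D `<=` X ->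
    measurable_fun D (fun x => (iter_density n x)%:E).
  move=> mD DX; apply/measurable_EFinP; apply: measurable_funS DX _.
    exact: measurable_column_space.
  exact: measurable_iter_density.
rewrite -{1 2}(bigcup_height_part n AX) ge0_integral_bigcup//; last 3 first.
- by rewrite bigcup_height_part//; exact: mf.
- move=> x; rewrite bigcup_height_part// => /AX Xx.
  by rewrite lee_fin iter_density_ge0.
- exact: trivIset_height_part.
rewrite image_bigcup measure_semi_bigcup; last 3 first.
- by move=> i; exact: measurable_iter_image.
- move=> i j _ _ [y [[x xi <-] [x' x'j /esym]]].
  move=> /(iter_column_inj (PX _ _ xi) (PX _ _ x'j)) xx'.
  apply: (@trivIset_height_part n A i j Logic.I Logic.I); exists x; split => //.
  by rewrite xx'.
- by rewrite -image_bigcup bigcup_height_part//; exact: measurable_iter_image.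
apply: eq_eseriesr => i _.
have [->|[k [p [k0 pnq sub]]]] := height_partP n A i.
  by rewrite image_set0 measure0 integral_set0.
transitivity ((level_ratio n k p)%:E * mu (height_part n A i))%E.
  exact: (measure_iter_level k0 pnq (mP i) sub).
rewrite -(integral_cst mu (mP i)).
by apply: eq_integral => x /[!inE] /sub xp; rewrite (iter_densityE k0 pnq xp).
Qed.

Lemma omega_is_density n :
  is_density mu X (fun A => mu (iter n T @` A)) (omega mu X T n).
Proof. by apply: (xgetPex (cst 0)); exists (iter_density n); exact: is_density_iter. Qed.

(** [omega] is an arbitrary version of the density; on a level, which has finite
measure, two versions have the same integrals and so agree almost everywhere. *)
Lemma omega_level n k p : (0 < k)%N -> (p + n < q k)%N ->
  mu.-negligible (lev k p `&` [set x | omega mu X T n x != level_ratio n k p]).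
Proof.
move=> k0 pnq; have [mw w0 wE] := omega_is_density n.
have pX : lev k p `<=` X by move=> x xp; apply: (column_spaceP k0 _ xp); lia.
have mp : measurable (lev k p) by exact: measurable_level.
have : ae_eq mu (lev k p) (cst (level_ratio n k p)%:E) (EFin \o omega mu X T n).
  apply: integral_ae_eq => //.
  - apply/integrableP; split => //; rewrite (integral_cst mu mp)/= measure_level.
      by rewrite -EFinM ltry.
    by rewrite ltW// column_length_gt0//; lia.
  - apply/measurable_EFinP; apply: measurable_funS pX mw.
    exact: measurable_column_space.
  - move=> E Ep mE; rewrite (integral_cst mu mE)/= -(measure_iter_level k0 pnq)//.
    by rewrite wE//; exact: subset_trans pX.
apply: negligibleS => x [xp /eqP wx] /= /(_ xp) wE'.
by apply: wx; case: wE'.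
Qed.

Lemma nonsingular_column_map : nonsingular mu X T.
Proof.
have iter1 A : T @` A = iter 1 T @` A by [].
split.
- exact: measurable_column_space.
- split; first by move=> x; exact: (iter_column_space 1).
  + by move=> x y /[!inE] Xx Xy; exact: (iter_column_inj (n := 1)).
  + by move=> y /column_map_surj[x Xx Txy]; exists x.
- exact: (measurable_iter 1).
- by move=> A mA AX; rewrite iter1; exact: measurable_iter_image.
- move=> A mA AX; rewrite iter1; split => [TA0|A0].
    apply: (null_of_null_levels (n := 1)) => // k p k0 pnq.
    have mAp : measurable (A `&` lev k p).
      by apply: measurableI => //; exact: measurable_level.
    have : mu (iter 1 T @` (A `&` lev k p)) = 0%E.
      apply: subset_measure0 TA0; [..|by apply: image_subset => x []];
        apply: measurable_iter_image => //.
      by move=> x [/AX].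
    rewrite (measure_iter_level k0 pnq mAp (@subIsetr _ _ _)).
    move=> /eqP; rewrite mule_eq0 => /orP[|/eqP//].
    by rewrite eqe gt_eqF// level_ratio_gt0.
  have [mf f0 fE] := is_density_iter 1; have /= -> := fE _ mA AX.
  rewrite null_set_integral//; apply/measurable_EFinP.
  by apply: measurable_funS AX mf; exact: measurable_column_space.
Qed.

(** * Density of a set in the levels of late columns *)

Definition mostly_in A (delta : R) k p :=
  (mu (lev k p `\` A) <= (delta * (C k p).2)%:E)%E.

Lemma measure_column_level k p : (0 < k)%N -> (p < q k)%N -> mu (lev k p) = (C k p).2%:E.
Proof. by move=> k0 pq; rewrite measure_level// ltW// column_length_gt0. Qed.

Lemma measure_level_setD A k p : (0 < k)%N -> (p < q k)%N -> measurable A ->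
  (mu (lev k p `\` A) <= (C k p).2%:E)%E.
Proof.
move=> k0 pq mA; rewrite -measure_column_level//; apply: le_measure; rewrite ?inE.
- by apply: measurableD => //; exact: measurable_level.
- exact: measurable_level.
- exact: subDsetl.
Qed.

Lemma positive_level A : measurable A -> A `<=` X -> (0 < mu A)%E ->
  exists k p, [/\ (0 < k)%N, (p < q k)%N & (0 < mu (A `&` lev k p))%E].
Proof.
move=> mA AX A0; apply: contrapT => nul.
suff E : mu A = 0%E by rewrite E ltxx in A0.
apply: (null_of_null_levels (n := 0)) => // k p k0; rewrite addn0 => pq.
apply/eqP; rewrite eq_le measure_ge0 andbT leNgt; apply/negP => Ap.
by apply: nul; exists k, p.
Qed.

Section inner_levels.
Variable U : set R.

Let inner k (p : nat) : set R := if `[< lev k p `<=` U >] then lev k p else set0.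
Let inner_union k : set R := \bigcup_(p in `I_(q k)) inner k p.

Let innerP k p : inner k p = set0 \/ inner k p = lev k p.
Proof. by rewrite /inner; case: ifP => _; [right|left]. Qed.

Let measurable_inner k p : measurable (inner k p).
Proof. by have [->//|->] := innerP k p; exact: measurable_level. Qed.

Let measurable_inner_union k : measurable (inner_union k).
Proof. by apply: bigcup_measurable => p _; exact: measurable_inner. Qed.

Let measure_inner_union k B : (0 < k)%N -> measurable B ->
  mu (inner_union k `&` B) = (\sum_(p < q k) mu (inner k p `&` B))%E.
Proof.
move=> k0 mB; rewrite setI_bigcupl bigcup_mkord measure_bigsetU_ord//.
  by move=> i; apply: measurableI => //; exact: measurable_inner.
move=> i j _ _ [x [[xi _] [xj _]]]; apply/val_inj.
have [E|iE] := innerP k i; first by rewrite E in xi.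
have [E|jE] := innerP k j; first by rewrite E in xj.
by rewrite iE in xi; rewrite jE in xj; exact: column_disjoint xi xj.
Qed.

Let inner_union_sub k : inner_union k `<=` U.
Proof. by move=> x [p _]; rewrite /inner; case: ifPn => // /asboolP; apply. Qed.

Let inner_union_nondecreasing : nondecreasing_seq (fun i => inner_union i.+1).
Proof.
apply/nondecreasing_seqP => i; apply/subsetPset => x [p /= pq].
rewrite {1}/inner; case: ifPn => // /asboolP pU xp.
have [j ja xj] := column_refine (ltn0Sn i) pq xp.
exists (j * q i.+1 + p)%N; first by apply: piece_index_lt.
rewrite /inner; case: ifPn => // /asboolP; case.
exact: subset_trans (subcolumn_sub (ltn0Sn i) ja pq) pU.
Qed.

(** As the levels shrink, those inside an open set exhaust its points. *)
Let open_inner_union : open U -> X `&` U `<=` \bigcup_i inner_union i.+1.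
Proof.
move=> oU x [Xx Ux]; have /nbhs_ballP[e /= e0 xeU] := open_nbhs_nbhs (conj oU Ux).
have [K K0 HK] := column_mesh e0.
have [k [p [Kk k0 pq xp]]] := column_space_height 0 K Xx; rewrite addn0 in pq.
exists k.-1 => //; rewrite prednK//; exists p => //.
rewrite /inner; case: ifPn => // /asboolP; case => y yp; apply: xeU.
have := HK _ _ Kk pq; move: xp yp; rewrite /level/= !in_itv/=.
move=> /andP[x1 x2] /andP[y1 y2] le; rewrite /ball/=; apply/ltr_normlP; split; lra.
Qed.

(** If A missed more than the proportion delta of every level of C_k inside U, it
would miss more than the proportion delta of their union. For late k this union
has more than half the measure of A, so that U would exceed A by too much. *)
Lemma mostly_in_open A delta : open U -> measurable A -> A `<=` X `&` U ->
  (0 < mu A < +oo)%E -> 0 < delta ->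
  (mu (U `\` A) < (delta / 2)%:E * mu A)%E ->
  exists2 K, (0 < K)%N & forall k, (K <= k)%N ->
    exists2 p, (p < q k)%N & mostly_in A delta k p.
Proof.
move=> oU mA AXU /andP[A0 Aoo] d0 UA.
have mU : measurable U by exact: open_measurable.
have mG i : measurable (A `&` inner_union i.+1) by exact: measurableI.
have GA : \bigcup_i (A `&` inner_union i.+1) = A.
  rewrite -setI_bigcupr; apply/setIidl.
  exact: subset_trans AXU (open_inner_union oU).
have ndG : nondecreasing_seq (fun i => A `&` inner_union i.+1).
  move=> i j ij; apply/subsetPset; apply: setIS.
  by have /subsetPset := inner_union_nondecreasing ij.
have cvgG := nondecreasing_cvg_mu (mu := mu) mG (bigcupT_measurable _ mG) ndG.
have muAE : mu A = (fine (mu A))%:E by rewrite fineK// ge0_fin_numE// ltW.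
have half_nbhs : nbhs (mu A) [set y | (2^-1)%:E * mu A < y]%E.
  apply: open_nbhs_nbhs; split; first exact: open_ereal_gt_ereal.
  have : (0 < (fine (mu A))%:E)%E by rewrite -muAE.
  by rewrite /= muAE -EFinM !lte_fin; lra.
rewrite GA in cvgG; have [N _ HN] := cvgG _ half_nbhs.
exists N.+1 => // -[//|k]; rewrite ltnS => Nk.
apply: contrapT => sparse.
have {}sparse p : (p < q k.+1)%N -> (delta%:E * mu (lev k.+1 p) <= mu (lev k.+1 p `\` A))%E.
  move=> pq; rewrite measure_column_level// -EFinM leNgt; apply/negP => lt.
  by apply: sparse; exists p => //; exact: ltW.
have := HN _ Nk; apply/negP; rewrite -leNgt.
suff : (delta%:E * mu (inner_union k.+1) <= (delta / 2)%:E * mu A)%E.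
  rewrite EFinM -muleA lee_pmul2l ?lte_fin//.
  apply: le_trans; apply: le_measure; rewrite ?inE.
  - exact: mG.
  - exact: measurable_inner_union.
  - exact: subIsetr.
apply: le_trans (ltW UA); apply: (@le_trans _ _ (mu (inner_union k.+1 `\` A))); last first.
  apply: le_measure; rewrite ?inE.
  - by apply: measurableD => //; exact: measurable_inner_union.
  - exact: measurableD.
  - by apply: setSD; exact: inner_union_sub.
rewrite setDE measure_inner_union//; last exact: measurableC.
rewrite -[X in (_ * mu X)%E]setIT measure_inner_union// ge0_sume_distrr//.
apply: lee_sum => p _; rewrite setIT.
have [->|->] := innerP k.+1 p; first by rewrite measure0 mule0.
by rewrite -setDE sparse.
Qed.

End inner_levels.

(** The density theorem for the partitions into levels: outer regularity provides
the open set of [mostly_in_open], after A is cut down to a level to make its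
measure finite. *)
Lemma mostly_in_levels A delta : measurable A -> A `<=` X -> (0 < mu A)%E -> 0 < delta ->
  exists2 K, (0 < K)%N & forall k, (K <= k)%N ->
    exists2 p, (p < q k)%N & mostly_in A delta k p.
Proof.
move=> mA AX A0 d0; have [k0 [p0 [k0_gt0 pq0 B0]]] := positive_level mA AX A0.
set B := A `&` lev k0 p0 in B0.
have mB : measurable B by apply: measurableI => //; exact: measurable_level.
have Boo : (mu B < +oo)%E.
  apply: (@le_lt_trans _ _ (mu (lev k0 p0))).
    by apply: le_measure; rewrite ?inE//; [exact: measurable_level|exact: subIsetr].
  by rewrite measure_column_level// ltry.
have muBE : mu B = (fine (mu B))%:E by rewrite fineK// ge0_fin_numE// ltW.
have e0 : 0 < delta / 2 * fine (mu B).
  by rewrite mulr_gt0 ?divr_gt0// -lte_fin -muBE.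
have [U [oU BU UB]] := lebesgue_regularity_outer mB Boo e0.
have BXU : B `<=` X `&` U by move=> x Bx; split; [exact: AX Bx.1|exact: BU].
have B0oo : (0 < mu B < +oo)%E by rewrite B0.
have UB' : (mu (U `\` B) < (delta / 2)%:E * mu B)%E by rewrite muBE -EFinM.
have [K K0 HK] := mostly_in_open oU mB BXU B0oo d0 UB'.
exists K => // k Kk; have [p pq Bp] := HK k Kk; exists p => //.
apply: le_trans Bp; apply: le_measure; rewrite ?inE.
- by apply: measurableD => //; exact: measurable_level.
- by apply: measurableD => //; exact: measurable_level.
- by apply: setDS => x [].
Qed.

(** Transporting B back along the iterate keeps its proportion, so that two
proportions above one half must overlap. *)
Lemma mostly_in_overlap A B delta n k p : (0 < k)%N -> (p + n < q k)%N ->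
  measurable A -> A `<=` X -> measurable B -> delta < 2^-1 ->
  mostly_in A delta k p -> mostly_in B delta k (p + n) ->
  (0 < mu (lev k p `&` (A `&` iter n T @^-1` B)))%E.
Proof.
move=> k0 pnq mA AX mB d2 Ap Bp; have pq : (p < q k)%N by lia.
have l0 := column_length_gt0 k0 pq; have l0' := column_length_gt0 k0 pnq.
have mG : measurable (lev k p `&` (A `&` iter n T @^-1` B)).
  rewrite -(setIidl AX) -setIA; apply: measurableI; first exact: measurable_level.
  apply: measurableI => //; apply: measurable_iter => //.
  exact: measurable_column_space.
set G := lev k p `&` _ in mG *.
pose H := level_map (C k (p + n)) (C k p) @` (lev k (p + n) `\` B).
have mD : measurable (lev k (p + n) `\` B).
  by apply: measurableD => //; exact: measurable_level.
have mDA : measurable (lev k p `\` A).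
  by apply: measurableD => //; exact: measurable_level.
have mH : measurable H by apply: measurable_level_map_image; rewrite ?gt_eqF.
have muH : (mu H <= (delta * (C k p).2)%:E)%E.
  rewrite measure_level_map_image//.
  apply: (@le_trans _ _ (((C k p).2 / (C k (p + n)).2)%:E *
      (delta * (C k (p + n)).2)%:E)%E).
    by rewrite lee_pmul2l// lte_fin divr_gt0.
  rewrite -EFinM lee_fin le_eqVlt; apply/orP; left; apply/eqP; field.
  by rewrite gt_eqF.
have cover : lev k p `<=` G `|` ((lev k p `\` A) `|` H).
  move=> x xp; have [Ax|nAx] := pselect (A x); last by right; left.
  have [Bx|nBx] := pselect (B (iter n T x)); first by left.
  right; right; exists (iter n T x).
    by split => //; exact: iter_level.
  by rewrite (iter_level_map k0 pnq xp) level_mapK ?gt_eqF.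
rewrite lt_neqAle measure_ge0 andbT eq_sym; apply/eqP => G0.
have : (mu (lev k p) <= mu G + (mu (lev k p `\` A) + mu H))%E.
  apply: (@le_trans _ _ (mu (G `|` ((lev k p `\` A) `|` H)))).
    apply: le_measure; rewrite ?inE//; first exact: measurable_level.
    by apply: measurableU => //; exact: measurableU.
  apply: le_trans; first by apply: measureU2 => //; exact: measurableU.
  by apply: leeD => //; exact: measureU2.
rewrite G0 add0e measure_column_level//.
move=> /le_trans/(_ (leeD Ap muH)); rewrite -EFinD lee_fin.
by nra.
Qed.

(** * Returns with a prescribed derivative *)

(** The proportion of the missing part in a level is an average of those in its
pieces. *)
Lemma sum_missing_le A delta k p s h : (0 < k)%N -> (p < q k)%N -> (s + h <= a k)%N ->
  measurable A -> mostly_in A delta k p ->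
  \sum_(j < h) fine (mu (lev k.+1 ((s + j) * q k + p) `\` A)) <= delta * (C k p).2.
Proof.
move=> k0 pq sh mA Ap; have mlev k' p' : measurable (lev k' p') by exact: measurable_level.
rewrite -lee_fin; apply: le_trans Ap.
rewrite -sumEFin (eq_bigr (fun j : 'I_h => mu (lev k.+1 ((s + j) * q k + p) `\` A))).
  pose F j := lev k.+1 ((s + j) * q k + p) `\` A.
  apply: (@sum_sub_measure _ _ _ mu h _ F); first exact: (measurableD (mlev _ _) mA).
    move=> j jh; split; first exact: (measurableD (mlev _ _) mA).
    by apply: setSD; apply: subcolumn_sub => //; lia.
  move=> i j x ih jh [xi _] [xj _].
  have E : ((s + i) * q k + p = (s + j) * q k + p)%N.
    by apply: column_disjoint xi xj => //; apply: piece_index_lt => //; lia.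
  by have := cf_q_gt0 a_gt0 k0; nia.
move=> j _; rewrite fineK// ge0_fin_numE//; apply: le_lt_trans (measure_level_setD _ _ mA) _ => //.
  by apply: piece_index_lt => //; have := ltn_ord j; lia.
by rewrite ltry.
Qed.

(** The left pieces that have a right counterpart carry at least 1/3 of the first
level, and their counterparts at least lambda/3 of the second one. So the average
proportions missed by these pieces are at most 3/lambda times larger, whatever
the number of pieces, and the remaining factor 2 is the price for one rank that
serves both levels. The levels may be given in either order, since pieces are
stacked from left to right. *)
Lemma mostly_in_split A delta k p p' : (0 < k)%N -> (2 <= a k)%N ->
  (p < q k)%N -> (p' < q k)%N -> measurable A -> 0 < delta ->
  mostly_in A delta k p -> mostly_in A delta k p' ->
  exists s s', [/\ (s < s')%N, (s' < q k.+1)%N,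
    mostly_in A (6 / lambda * delta) k.+1 s, mostly_in A (6 / lambda * delta) k.+1 s' &
    (C k.+1 s').2 / (C k.+1 s).2 = lambda * ((C k p').2 / (C k p).2)].
Proof.
move=> k0 ak pq pq' mA d0 Ap Ap'; have l0 := lambda_gt0; have l1 := lambda_lt1.
pose h := (a k)./2; pose c := uphalf (a k).
have h0 : (0 < h)%N by rewrite half_gt0.
have ch : (c + h = a k)%N by rewrite /c /h; lia.
have c2h : (c <= 2 * h)%N by rewrite /c /h; lia.
have c0 : (0 < c)%N by lia.
have leL : (0 + h <= a k)%N by lia.
have leR : (c + h <= a k)%N by lia.
have ranks j : (j < h)%N -> [/\ (j < c)%N, (j < a k)%N, (c + j < a k)%N &
    (j * q k + p < (c + j) * q k + p')%N].
  by move=> jh; split; [lia|lia|lia|nia].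
have J0 := column_length_gt0 k0 pq; have J0' := column_length_gt0 k0 pq'.
have U0 : 0 < delta * (C k p).2 by rewrite mulr_gt0.
have V0 : 0 < delta * (C k p').2 by rewrite mulr_gt0.
pose u j := fine (mu (lev k.+1 (j * q k + p) `\` A)).
pose v j := fine (mu (lev k.+1 ((c + j) * q k + p') `\` A)).
have sumL : \sum_(j < h) u j <= delta * (C k p).2.
  exact: (sum_missing_le k0 pq leL mA Ap).
have sumR : \sum_(j < h) v j <= delta * (C k p').2.
  exact: (sum_missing_le k0 pq' leR mA Ap').
have u0 j : 0 <= u j by rewrite fine_ge0.
have v0 j : 0 <= v j by rewrite fine_ge0.
have [j jh [uj vj]] := exists_two_averages h0 U0 V0 u0 v0 sumL sumR.
have [jc ja ja' ss'] := ranks _ jh.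
exists (j * q k + p)%N, ((c + j) * q k + p')%N.
have sq := piece_index_lt k0 ja pq; have sq' := piece_index_lt k0 ja' pq'.
pose D : R := c%:R + lambda * h%:R.
have hR : 0 < h%:R :> R by rewrite ltr0n.
have D0 : 0 < D by apply: den_gt0 => //; exact: a_gt0.
have D3 : D <= 3 * h%:R.
  have : (c%:R : R) <= 2 * h%:R by rewrite -natrM ler_nat.
  by rewrite /D; nra.
have lenL : (C k.+1 (j * q k + p)).2 = (C k p).2 / D.
  rewrite (column_cut col)//= /piece_length -/c jc.
  by rewrite mul1r mulrC.
have lenR : (C k.+1 ((c + j) * q k + p')).2 = lambda * (C k p').2 / D.
  rewrite (column_cut col)//= /piece_length -/c ltnNge leq_addr/=.
  by rewrite -/h -/D mulrAC.
have missing B t b : (t < q k.+1)%N -> fine (mu (lev k.+1 t `\` A)) <= 2 * B / h%:R ->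
    2 * B / h%:R <= b -> (mu (lev k.+1 t `\` A) <= b%:E)%E.
  move=> tq; rewrite -!lee_fin => H1 H2; apply: le_trans H2; apply: le_trans H1.
  rewrite fineK// ge0_fin_numE//; apply: le_lt_trans (measure_level_setD _ tq mA) _ => //.
  by rewrite ltry.
have D3' : h%:R^-1 <= 3 / D by rewrite ler_pdivlMr// mulrC ler_pdivrMr.
split => //.
- rewrite /mostly_in; apply: missing uj _ => //; rewrite lenL.
  apply: (@le_trans _ _ (2 * (delta * (C k p).2) * (3 / D))).
    by rewrite ler_wpM2l// mulr_ge0// ltW.
  have -> : 2 * (delta * (C k p).2) * (3 / D) = (6 * delta) * ((C k p).2 / D).
    by field; rewrite gt_eqF.
  rewrite ler_wpM2r ?divr_ge0 ?(ltW J0) ?(ltW D0)// ler_wpM2r ?(ltW d0)//.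
  by rewrite ler_pdivlMr//; nra.
- rewrite /mostly_in; apply: missing vj _ => //; rewrite lenR.
  apply: (@le_trans _ _ (2 * (delta * (C k p').2) * (3 / D))).
    by rewrite ler_wpM2l// mulr_ge0// ltW.
  rewrite le_eqVlt; apply/orP; left; apply/eqP; field.
  by rewrite !gt_eqF.
- by rewrite lenL lenR; field; rewrite !gt_eqF.
Qed.

Lemma column_no_cut k p : (0 < k)%N -> a k = 1%N -> (p < q k)%N -> C k.+1 p = C k p.
Proof.
move=> k0 ak pq; have := column_cut col k0 (j := 0) _ pq; rewrite mul0n add0n ak => -> //.
rewrite /piece /piece_length /= big_ord0 addr0 mulr0 addr0 divr1 mul1r.
by case: (C k p).
Qed.

(** Stages with a single piece leave the levels unchanged, so one can wait for a
stage that really cuts. *)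
Lemma next_cut k : (0 < k)%N -> exists k', [/\ (k <= k')%N, (2 <= a k')%N &
  forall p, (p < q k)%N -> (p < q k')%N /\ C k' p = C k p].
Proof.
move=> k0; have [k1 [kk1 ak1]] := a_ge2 k.
have [d kE] : exists d, (d + k = k1)%N by exists (k1 - k)%N; lia.
clear kk1; elim: d k k0 kE => [|d IH] k k0 kE.
  by exists k; split => //; rewrite -kE in ak1.
have [ak|ak] := leqP 2 (a k); first by exists k.
have {}ak : a k = 1%N by have := a_gt0 k0; lia.
have [//||k' [kk' ak' CE]] := IH k.+1; first by lia.
exists k'; split => //; first by lia.
move=> p pq; have pq1 : (p < q k.+1)%N by rewrite cf_qS// ak; lia.
by have [? ->] := CE p pq1; rewrite column_no_cut.
Qed.

Lemma mostly_in_pair A delta k p p' : (0 < k)%N ->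
  (p < q k)%N -> (p' < q k)%N -> measurable A -> 0 < delta ->
  mostly_in A delta k p -> mostly_in A delta k p' ->
  exists k1 s s', [/\ (0 < k1)%N, (s < s')%N /\ (s' < q k1)%N,
    mostly_in A (6 / lambda * delta) k1 s, mostly_in A (6 / lambda * delta) k1 s' &
    (C k1 s').2 / (C k1 s).2 = lambda * ((C k p').2 / (C k p).2)].
Proof.
move=> k0 pq pq' mA d0 Ap Ap'; have [k1 [kk1 ak1 CE]] := next_cut k0.
have [pq1 E] := CE p pq; have [pq1' E'] := CE p' pq'; have k10 : (0 < k1)%N by lia.
rewrite /mostly_in -E in Ap; rewrite /mostly_in -E' in Ap'.
have [s [s' [ss sq Hs Hs' ratio]]] := mostly_in_split k10 ak1 pq1 pq1' mA d0 Ap Ap'.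
by exists k1.+1, s, s'; split => //; rewrite ratio E E'.
Qed.

Lemma mostly_in_pairs N A delta k p : (0 < k)%N -> (p < q k)%N ->
  measurable A -> 0 < delta -> mostly_in A delta k p ->
  exists k1 s s', [/\ (0 < k1)%N, (s < q k1)%N /\ (s' < q k1)%N,
    mostly_in A ((6 / lambda) ^+ N * delta) k1 s,
    mostly_in A ((6 / lambda) ^+ N * delta) k1 s' &
    (C k1 s').2 / (C k1 s).2 = lambda ^+ N].
Proof.
move=> k0 pq mA d0 Ap; have l0 := lambda_gt0; elim: N => [|N].
  exists k, p, p; rewrite !expr0 mul1r divff ?gt_eqF//.
  exact: column_length_gt0.
move=> [k1 [s [s' [k10 [sq sq'] Hs Hs' ratio]]]].
have d1 : 0 < (6 / lambda) ^+ N * delta by rewrite mulr_gt0// exprn_gt0// divr_gt0.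
have [k2 [t [t' [k12 [tt tq] Ht Ht' r2]]]] := mostly_in_pair k10 sq sq' mA d1 Hs Hs'.
exists k2, t, t'; rewrite exprS -mulrA; split => //.
  by split => //; exact: ltn_trans tq.
by rewrite r2 ratio exprS.
Qed.

(** Going from left to right pieces N times multiplies the ratio of the
lengths by the N-th power of lambda, and exchanging the two levels inverts this
ratio. One more passage from left to right puts the second level above the first
one, which makes the return time positive. *)
Lemma return_with_ratio A (m : int) : measurable A -> A `<=` X -> (0 < mu A)%E ->
  exists n k p, [/\ (0 < n)%N, (0 < k)%N, (p + n < q k)%N,
    level_ratio n k p = lambda ^ m &
    (0 < mu (lev k p `&` (A `&` iter n T @^-1` A)))%E].
Proof.
move=> mA AX A0; have l0 := lambda_gt0; pose N := `|m - 1|%N.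
have N_ge1 : 1 <= m -> m - 1 = N%:Z by rewrite /N; lia.
have N_lt1 : m < 1 -> m - 1 = - N%:Z by rewrite /N; lia.
have c0 : 0 < 6 / lambda by rewrite divr_gt0.
(* The N splits and the last one turn delta into 1/3, which is below 1/2. *)
pose delta := ((6 / lambda) ^+ N.+1)^-1 / 3.
have d0 : 0 < delta by rewrite divr_gt0// invr_gt0 exprn_gt0.
have [k [p [k0 pq Ap]]] : exists k p, [/\ (0 < k)%N, (p < q k)%N & mostly_in A delta k p].
  have [K K0 HK] := mostly_in_levels mA AX A0 d0.
  by have [p pq Ap] := HK K (leqnn K); exists K, p.
pose delta' := (6 / lambda) ^+ N * delta.
have d0' : 0 < delta' by rewrite mulr_gt0// exprn_gt0.
have d3 : 6 / lambda * delta' = 3^-1.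
  rewrite /delta' mulrA -exprS /delta mulrA divff ?mul1r//.
  by rewrite gt_eqF// exprn_gt0.
have [k1 [s [s' [k10 [sq sq'] Hs Hs' ratio]]]] : exists k1 s s', [/\ (0 < k1)%N,
    (s < q k1)%N /\ (s' < q k1)%N, mostly_in A delta' k1 s, mostly_in A delta' k1 s' &
    (C k1 s').2 / (C k1 s).2 = lambda ^ (m - 1)].
  have [k1 [s [s' [k10 [sq sq'] Hs Hs' ratio]]]] := mostly_in_pairs N k0 pq mA d0 Ap.
  have [m1|m1] := leP 1 m.
    by exists k1, s, s'; split => //; rewrite ratio N_ge1.
  exists k1, s', s; split => //; rewrite -invf_div ratio.
  by rewrite N_lt1// -invr_expz.
have [k2 [t [t' [k12 [tt tq] Ht Ht' r2]]]] := mostly_in_pair k10 sq sq' mA d0' Hs Hs'.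
rewrite d3 in Ht Ht'; exists (t' - t)%N, k2, t.
have tn : (t + (t' - t) = t')%N by rewrite subnKC// ltnW.
split; rewrite ?tn ?subn_gt0//.
  rewrite /level_ratio tn r2 ratio -{1}[lambda]expr1z -expfzDr ?gt_eqF//.
  by rewrite addrC subrK.
apply: (mostly_in_overlap (delta := 3^-1)) => //; rewrite ?tn//.
by rewrite ltf_pV2 ?posrE// ltr_nat.
Qed.

(** * Conservativity, ergodicity and the ratio set *)

Lemma conservative_column_map : conservative mu X T.
Proof.
move=> W mW WX tW; apply/eqP; rewrite eq_le measure_ge0 andbT leNgt; apply/negP => W0.
have [n [k [p [n0 k0 pnq _ ret]]]] := return_with_ratio 0 mW WX W0.
have /set0P[x [_ [Wx TWx]]] : lev k p `&` (W `&` iter n T @^-1` W) != set0.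
  by apply/eqP => E; rewrite E measure0 ltxx in ret.
suff E : 0%N = n by rewrite -E in n0.
by apply: (tW 0%N n Logic.I Logic.I); exists x; split; split => //; exact: WX.
Qed.

(** A and its complement would each nearly fill a level of one column, and an
iterate of T maps the lower of these levels onto the higher one. *)
Lemma ergodic_column_map : ergodic mu X T.
Proof.
move=> A mA AX Ainv; set B := X `\` A.
have mB : measurable B by apply: measurableD => //; exact: measurable_column_space.
have BX : B `<=` X by move=> x [].
have step x : X x -> A (T x) <-> A x.
  move=> Xx; split => [ATx|Ax]; first by rewrite -Ainv.
  by move: Ax; rewrite -{1}Ainv => -[].
have iterA n x : X x -> A (iter n T x) <-> A x.
  move=> Xx; elim: n => //= n IH; rewrite -IH; apply: step.
  exact: iter_column_space.
apply: contrapT => /not_orP[/eqP nA /eqP nB].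
have A0 : (0 < mu A)%E by rewrite lt_neqAle eq_sym nA measure_ge0.
have B0 : (0 < mu B)%E by rewrite lt_neqAle eq_sym nB measure_ge0.
have d0 : 0 < 3^-1 :> R by rewrite invr_gt0.
have d2 : 3^-1 < 2^-1 :> R by rewrite ltf_pV2 ?posrE// ltr_nat.
have [K K0 HK] := mostly_in_levels mA AX A0 d0.
have [K' K'0 HK'] := mostly_in_levels mB BX B0 d0.
pose k := maxn K K'; have k0 : (0 < k)%N by rewrite leq_max K0.
have [p pq Ap] := HK k (leq_maxl _ _); have [p' pq' Bp'] := HK' k (leq_maxr _ _).
have nonempty D : (0 < mu D)%E -> exists x, D x.
  by move=> D0; apply/set0P/eqP => E; rewrite E measure0 ltxx in D0.
have [pp'|/ltnW p'p] := leqP p p'.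
  have E : (p + (p' - p) = p')%N by rewrite subnKC.
  rewrite -E in pq' Bp'.
  have [x [_ [Ax [_ nATx]]]] := nonempty _ (mostly_in_overlap k0 pq' mA AX mB d2 Ap Bp').
  by apply: nATx; apply/iterA => //; exact: AX.
have E : (p' + (p - p') = p)%N by rewrite subnKC.
rewrite -E in pq Ap.
have [x [_ [[Xx nAx] ATx]]] := nonempty _ (mostly_in_overlap k0 pq mB BX mA d2 Bp' Ap).
by apply: nAx; exact: (iterA (p - p')%N x Xx).1 ATx.
Qed.

(** The countably many exceptional null sets of [omega_level] are put together. *)
Lemma omega_power n : exists2 N, mu.-negligible N &
  forall x, X x -> ~ N x -> exists m : int, omega mu X T n x = lambda ^ m.
Proof.
exists (\bigcup_i (height_cover n i `&`
    [set x | forall m : int, omega mu X T n x != lambda ^ m])).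
  apply: negligible_bigcup => i.
  have [->|[k [p [k0 pnq ->]]]] := height_coverP n i.
    by rewrite set0I; exact: negligible_set0.
  apply: negligibleS (omega_level k0 pnq) => x [xp wx]; split => //=.
  have pq : (p < q k)%N by exact: leq_ltn_trans (leq_addr _ _) pnq.
  by have [m mE] := column_length_ratio k0 pq pnq; rewrite /level_ratio mE.
move=> x; rewrite -(bigcup_height_cover n) => -[i _ xi] nN.
apply: contrapT => nm; apply: nN; exists i => //; split => //= m.
by apply/eqP => wE; apply: nm; exists m.
Qed.

(** Of two distinct powers, the smaller one is at most lambda times the larger. *)
Lemma expz_dist (m m' : int) : lambda ^ m <> lambda ^ m' ->
  (1 - lambda) * lambda ^ m <= `|lambda ^ m - lambda ^ m'|.
Proof.
have l0 := lambda_gt0; have l1 := lambda_lt1 => mm'.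
have pm : 0 < lambda ^ m by rewrite exprz_gt0.
have pm' : 0 < lambda ^ m' by rewrite exprz_gt0.
have step (i j : int) : i < j -> lambda ^ j <= lambda * lambda ^ i.
  move=> ij; have -> : j = i + 1 + (absz (j - i - 1)%R)%:Z by lia.
  rewrite expfzDr ?gt_eqF// expfzDr ?gt_eqF// expr1z mulrC [leRHS]mulrC.
  apply: ler_piMl; first by rewrite mulr_ge0 ?exprz_ge0// ltW.
  by apply: exprn_ile1; exact: ltW.
have [mltm'|m'ltm|E] := ltgtP m m'; last by rewrite E in mm'.
  by have := step _ _ mltm'; rewrite ler_normr => h; apply/orP; left; lra.
have := step _ _ m'ltm; rewrite ler_normr => h; apply/orP; right.
by nra.
Qed.

Lemma measurable_iter_return n A : measurable A -> A `<=` X ->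
  measurable (A `&` iter n T @^-1` A).
Proof.
move=> mA AX; rewrite -{1}(setIidl AX) -setIA; apply: measurableI => //.
by apply: measurable_iter => //; exact: measurable_column_space.
Qed.

Lemma measurable_return_set n A t eps : measurable A -> A `<=` X ->
  measurable (A `&` iter n T @^-1` A `&` [set x | ball t eps (omega mu X T n x)]).
Proof.
move=> mA AX; have [mw _ _] := omega_is_density n.
have sub : A `&` iter n T @^-1` A `<=` X by move=> x [/AX].
rewrite -(setIidl sub) -setIA; apply: measurableI; first exact: measurable_iter_return.
apply: mw; first exact: measurable_column_space.
exact: measurable_ball.
Qed.

(** Elements of the ratio set are limits of powers of lambda, and these
accumulate only at 0. *)
Lemma ratio_set_column_map :
  ratio_set mu X T = [set lambda ^ n | n in [set: int]] `|` [set 0].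
Proof.
have l0 := lambda_gt0; have l1 := lambda_lt1.
apply/seteqP; split => [t [t0 tr]|t].
  have [->|tN0] := eqVneq t 0; first by right.
  left; have tgt0 : 0 < t by rewrite lt_neqAle eq_sym tN0.
  have near_power eps : 0 < eps -> exists m : int, `|t - lambda ^ m| < eps.
    move=> e0; have X0 : (0 < mu X)%E.
      apply: (@lt_le_trans _ _ (mu (lev 1 0))).
        by rewrite measure_column_level// lte_fin column_length_gt0.
      apply: le_measure; rewrite ?inE; [exact: measurable_level|exact: measurable_column_space|].
      by move=> x; exact: column_spaceP.
    have [n [_ pos]] := tr eps X e0 measurable_column_space (fun x Xx => Xx) X0.
    apply: contrapT => far; have [N Nneg HN] := omega_power n.
    have := pos; rewrite lt_neqAle eq_sym => /andP[/eqP + _]; apply.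
    apply: measure_negligible.
      by apply: measurable_return_set => //; exact: measurable_column_space.
    apply: negligibleS Nneg => x [[Xx _] /= xb]; apply: contrapT => nN.
    by have [m mE] := HN x Xx nN; apply: far; exists m; rewrite -mE.
  (* Two distinct powers this close to t would be closer to each other than
     [expz_dist] permits. *)
  have [m tm] := near_power (t * (1 - lambda) / 4) ltac:(nra).
  have [tE|tNm] := eqVneq t (lambda ^ m); first by exists m.
  have d0 : 0 < `|t - lambda ^ m| by rewrite normr_gt0 subr_eq0.
  have [m' tm'] := near_power _ d0.
  have mm' : lambda ^ m <> lambda ^ m'.
    by move=> E; rewrite E ltxx in tm'.
  have far := expz_dist mm'.
  have tri := ler_distD t (lambda ^ m) (lambda ^ m'); rewrite (distrC _ t) in tri.
  have tu : t - lambda ^ m <= `|t - lambda ^ m| by exact: ler_norm.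
  have : (1 - lambda) * lambda ^ m < (1 - lambda) * (t / 2).
    by apply: (le_lt_trans far); apply: (le_lt_trans tri); nra.
  rewrite ltr_pM2l ?subr_gt0// => u_lt.
  have : t * (1 - lambda) < t * 1 by rewrite ltr_pM2l//; lra.
  by lra.
move=> tP; have t0 : 0 <= t.
  by case: tP => [[m _ <-]|->//]; rewrite exprz_ge0// ltW.
split=> // eps A e0 mA AX A0.
have [m tm] : exists m : int, `|t - lambda ^ m| < eps.
  case: tP => [[m _ <-]|->]; first by exists m; rewrite subrr normr0.
  have r1 : `|lambda| < 1 by rewrite ger0_norm// ltW.
  have := cvg_expr r1 => /cvgrPdist_lt/(_ _ e0)[N _ /(_ N (leqnn N))/= H].
  by exists N%:Z.
have [n [k [p [n0 k0 pnq rE ret]]]] := return_with_ratio m mA AX A0.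
exists n; split => //; set S := (X in (0 < _ X)%E).
have mS : measurable S by exact: measurable_return_set.
rewrite lt_neqAle measure_ge0 andbT eq_sym; apply/eqP => S0.
suff E : mu (lev k p `&` (A `&` iter n T @^-1` A)) = 0%E by rewrite E ltxx in ret.
apply: measure_negligible.
  by apply: measurableI; [exact: measurable_level|exact: measurable_iter_return].
have Sneg : mu.-negligible S by exists S; split.
apply: negligibleS (negligibleU Sneg (omega_level k0 pnq)).
move=> x [xp [Ax TAx]]; have [wE|wx] := eqVneq (omega mu X T n x) (level_ratio n k p).
  by left; split => //=; rewrite wE rE.
by right.
Qed.

Lemma type_III_column_map : type_III mu X T lambda.
Proof.
split; [exact: nonsingular_column_map|exact: conservative_column_map|
  exact: ergodic_column_map|exact: ratio_set_column_map].
Qed.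

End construction.

Theorem theorem11p2 (R : realType) (alpha lambda : R)
    (C : nat -> nat -> R * R) (T : R -> R) :
  irrational alpha -> ~ golden_type alpha ->
  0 < lambda -> lambda < 1 ->
  column_construction (cf_nat alpha) lambda C ->
  column_map (cf_nat alpha) C T ->
  type_III (@lebesgue_measure R) (column_space (cf_nat alpha) C) T lambda.
Proof.
move=> irr ngold l0 l1 col colT.
apply: type_III_column_map => //.
- by move=> k; exact: cf_nat_gt0.
- exact: not_golden_cf_nat_ge2.
Qed.
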